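(* The cost function $\mathcal{J}(K)=\mathrm{tr}(P_KDD^\top)$ for continuous-time mixed $\mathcal{H}_2/\mathcal{H}_\infty$ design is not coercive in general: as $K$ approaches the boundary $\partial\mathcal{K}$ of the feasible set $\mathcal{K}$, $\mathcal{J}(K)$ does not necessarily approach infinity, i.e., there exist problem data $(A,B,C,D,E,\gamma)$ and a sequence in $\mathcal{K}$ converging to a point of $\partial\mathcal{K}$ along which $\mathcal{J}$ does not tend to $+\infty$.
   Context: Setting (continuous-time mixed $\mathcal{H}_2/\mathcal{H}_\infty$ design). $A\in\mathbb{R}^{m\times m}$, $B\in\mathbb{R}^{m\times d}$, $C\in\mathbb{R}^{l\times m}$, $D\in\mathbb{R}^{m\times n}$, $E\in\mathbb{R}^{l\times d}$ are real matrices satisfying $E^\top[C\ \ E]=[0\ \ R]$ for some $R>0$, and $\gamma>0$. Gains are $K\in\mathbb{R}^{d\times m}$. $X>0$ ($X\ge0$) denotes (symmetric) positive definite (semidefinite). A matrix is Hurwitz if all its eigenvalues have negative real part. Transfer function: $\mathcal{T}(K)(s)=(C^\top C+K^\top RK)^{1/2}(sI-(A-BK))^{-1}D$, with $\|\mathcal{T}(K)\|_\infty=\sup_{\omega\in\mathbb{R}}\sigma_{\max}[\mathcal{T}(K)(j\omega)]$. Feasible set: $\mathcal{K}=\{K: A-BK\text{ is Hurwitz},\ \|\mathcal{T}(K)\|_\infty<\gamma\}$. For $K\in\mathcal{K}$, $P_K\ge0$ denotes the unique stabilizing solution (it exists by the continuous-time Bounded Real Lemma) of $(A-BK)^\top P_K+P_K(A-BK)+C^\top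 C+K^\top RK+\gamma^{-2}P_KDD^\top P_K=0$, i.e., the unique solution with $A-BK+\gamma^{-2}DD^\top P_K$ Hurwitz. *)

(* Defs.v *)
From HB Require Import structures.
From mathcomp Require Import all_boot all_order all_algebra complex.
From mathcomp Require Import all_classical all_reals all_analysis.

Set Implicit Arguments.
Unset Strict Implicit.
Unset Printing Implicit Defensive.

Import Order.TTheory GRing.Theory Num.Theory.
Import numFieldNormedType.Exports.

Local Open Scope classical_set_scope.
Local Open Scope ring_scope.
Local Open Scope complex_scope.

Definition frontier (T : topologicalType) (S : set T) : set T :=
  closure S `\` interior S.

Section Matrices.
Variable R : realType.

Definition posdef_mx k (M : 'M[R]_k) : Prop :=
  M^T = M /\ forall x : 'cV[R]_k, x != 0 -> 0 < (x^T *m M *m x) 0 0.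

Definition possemidef_mx k (M : 'M[R]_k) : Prop :=
  M^T = M /\ forall x : 'cV[R]_k, 0 <= (x^T *m M *m x) 0 0.

(* A positive semidefinite M has exactly one positive semidefinite square
   root; for other matrices the value 0 is meaningless. *)
Definition sqrt_mx k (M : 'M[R]_k) : 'M[R]_k :=
  xget 0 [set S | possemidef_mx S /\ S *m S = M].

Definition complex_mx k1 k2 (M : 'M[R]_(k1, k2)) : 'M[R[i]]_(k1, k2) :=
  map_mx (real_complex R) M.

Definition hurwitz k (M : 'M[R]_k) : Prop :=
  forall z : R[i], eigenvalue (complex_mx M) z -> complex.Re z < 0.

Definition adjoint_mx k1 k2 (M : 'M[R[i]]_(k1, k2)) : 'M[R[i]]_(k2, k1) :=
  map_mx (fun z : R[i] => z^*) M^T.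

Definition singular_values k1 k2 (M : 'M[R[i]]_(k1, k2)) : set R :=
  [set s : R | 0 <= s /\ eigenvalue (adjoint_mx M *m M) (s ^+ 2)%:C].

(* The set of singular values is finite, and nonempty as soon as k2 > 0, so
   its supremum is then a maximum. *)
Definition sigma_max k1 k2 (M : 'M[R[i]]_(k1, k2)) : R :=
  sup (singular_values M).

End Matrices.

Section MixedDesign.
Variables (R : realType) (m d l n : nat).
Variables (A : 'M[R]_m) (B : 'M[R]_(m, d)) (C : 'M[R]_(l, m)).
Variables (D : 'M[R]_(m, n)) (Rw : 'M[R]_d) (gamma : R).
Implicit Types (K : 'M[R]_(d, m)) (P : 'M[R]_m).

Definition closed_loop K : 'M[R]_m := A - B *m K.

Definition state_weight K : 'M[R]_m := C^T *m C + K^T *m Rw *m K.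

Definition transfer K (s : R[i]) : 'M[R[i]]_(m, n) :=
  complex_mx (sqrt_mx (state_weight K))
    *m invmx (s%:M - complex_mx (closed_loop K)) *m complex_mx D.

Definition hinf_norm K : \bar R :=
  ereal_sup [set (sigma_max (transfer K (0 +i* w)))%:E | w in [set: R]].

Definition feasible : set 'M[R]_(d, m) :=
  [set K | hurwitz (closed_loop K) /\ (hinf_norm K < gamma%:E)%E].

Definition riccati_residual K P : 'M[R]_m :=
  (closed_loop K)^T *m P + P *m closed_loop K + state_weight K
    + gamma ^- 2 *: (P *m D *m D^T *m P).

Definition stabilizing_solution K P : Prop :=
  [/\ possemidef_mx P, riccati_residual K P = 0
    & hurwitz (closed_loop K + gamma ^- 2 *: (D *m D^T *m P))].

(* Meaningful only where the stabilizing solution exists and is unique, in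
   particular on the feasible set (Bounded Real Lemma). *)
Definition riccati_P K : 'M[R]_m := xget 0 [set P | stabilizing_solution K P].

Definition cost K : R := \tr (riccati_P K *m D *m D^T).

End MixedDesign.

(* Main.v *)
Require Import Defs.
From HB Require Import structures.
From mathcomp Require Import all_boot all_order all_algebra complex.
From mathcomp Require Import all_classical all_reals all_analysis.
From mathcomp Require Import ring lra.
Import Order.TTheory GRing.Theory Num.Theory.
Import numFieldNormedType.Exports.
Local Open Scope classical_set_scope.
Local Open Scope ring_scope.

(** One state suffices. For the plant [x' = - x + u + w] with cost weight
    [u ^ 2] (that is [A = -1], [B = D = E = 1], [C = 0]) and [gamma = 1], the
    transfer function of the gain [k > -1] is [|k| / (s + 1 + k)]; its modulus
    on the imaginary axis peaks at [s = 0], so [k] is feasible exactly when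
    [|k| < k + 1], that is [k > -1/2] ([feasible_scalar]). The Riccati equation
    is the quadratic [p ^ 2 - 2 (k + 1) p + k ^ 2 = 0], of discriminant
    proportional to [2 k + 1], and its smaller root is the stabilizing one. At
    the boundary the two roots merely collide, at the finite value [1/2], so
    the cost [J(k) = p] stays bounded: this is why it is not coercive.

    Writing [2 k + 1 = t ^ 2] with [t > 0] makes the roots [(1 - t) ^ 2 / 2] and
    [(1 + t) ^ 2 / 2] rational in [t]; the sequence of gains is obtained with
    [t = 1 / (i + 1)], and its costs are at most [1/2]. *)

(** * Scalar matrices *)

Lemma eigenvalue_scalar (F : fieldType) (n : nat) (a z : F) :
  eigenvalue (a%:M : 'M[F]_n.+1) z = (z == a).
Proof.
apply/eigenvalueP/eqP => [[v]|->].
  rewrite mul_mx_scalar => /eqP; rewrite -subr_eq0 -scalerBl scaler_eq0.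
  by rewrite subr_eq0 => /orP[/eqP ->|-> //].
exists (const_mx 1); first by rewrite mul_mx_scalar.
by apply/eqP => /rowP /(_ 0); rewrite !mxE => /eqP; rewrite oner_eq0.
Qed.

Lemma hurwitz_scalar (R : realType) (n : nat) (a : R) :
  hurwitz (a%:M : 'M[R]_n.+1) <-> a < 0.
Proof.
rewrite /hurwitz /complex_mx map_scalar_mx; split.
  by move=> /(_ (real_complex R a)); rewrite eigenvalue_scalar eqxx; apply.
by move=> a0 z; rewrite eigenvalue_scalar => /eqP ->.
Qed.

Lemma quad_form_scalar (R : realType) (a : R) (x : 'cV[R]_1) :
  (x^T *m a%:M *m x) 0 0 = a * x 0 0 ^+ 2.
Proof.
rewrite [x]mx11_scalar tr_scalar_mx -!scalar_mxM !mxE eqxx !mulr1n; ring.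
Qed.

Lemma possemidef_scalar (R : realType) (a : R) :
  possemidef_mx (a%:M : 'M[R]_1) <-> 0 <= a.
Proof.
split=> [[_ /(_ 1%:M)]|a0]; first by rewrite quad_form_scalar mxE expr1n mulr1.
split=> [|x]; first exact: tr_scalar_mx.
by rewrite quad_form_scalar mulr_ge0 ?sqr_ge0.
Qed.

Lemma posdef_scalar (R : realType) (a : R) :
  0 < a -> posdef_mx (a%:M : 'M[R]_1).
Proof.
move=> a0; split=> [|x x0]; first exact: tr_scalar_mx.
rewrite quad_form_scalar mulr_gt0 ?exprn_even_gt0 //=.
by apply: contraNneq x0 => x00; rewrite [x]mx11_scalar x00 raddf0.
Qed.

Lemma scalar_mx11_inj (V : nmodType) : injective (fun a : V => a%:M : 'M[V]_1).
Proof. by move=> a b /matrixP /(_ 0 0); rewrite !mxE !mulr1n. Qed.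

Lemma sqrt_mx_scalar (R : realType) (a : R) :
  0 <= a -> sqrt_mx (a%:M : 'M[R]_1) = (Num.sqrt a)%:M.
Proof.
move=> a0; apply: xget_unique => [|S [Spsd SS]].
  split; first by apply/possemidef_scalar; exact: sqrtr_ge0.
  by rewrite -scalar_mxM -expr2 sqr_sqrtr.
move: Spsd SS; rewrite [S]mx11_scalar => /possemidef_scalar s0.
rewrite -scalar_mxM => /scalar_mx11_inj <-.
by rewrite -expr2 sqrtr_sqr ger0_norm.
Qed.

Lemma sigma_max_scalar (R : realType) (z : R[i]%C) :
  sigma_max (z%:M : 'M[R[i]%C]_1) = ComplexField.Normc.normc z.
Proof.
rewrite /sigma_max /singular_values -[RHS]sup1; congr sup.
have -> : adjoint_mx (z%:M : 'M[R[i]%C]_1) *m z%:M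
    = (real_complex R (ComplexField.Normc.normc z ^+ 2))%:M.
  rewrite /adjoint_mx tr_scalar_mx map_scalar_mx -scalar_mxM.
  by rewrite rmorphXn /= mulrC -sqr_normc.
have nz0 : 0 <= ComplexField.Normc.normc z by case: z => x y; exact: sqrtr_ge0.
apply/seteqP; split=> [s [s0]|s ->]; last first.
  by split=> //; rewrite eigenvalue_scalar.
rewrite eigenvalue_scalar => /eqP /complexI /eqP.
by rewrite eqrXn2 // => /eqP.
Qed.

Lemma cvg_scalar_mx (R : realType) (n : nat) (u : nat -> R) (a : R) :
  u i @[i --> \oo] --> a ->
  (u i)%:M @[i --> \oo] --> (a%:M : 'M[R]_n.+1).
Proof.
move=> ua.
have := @cvgZr_tmp R 'M[R]_(n.+1, n.+1) nat _ _ _ _ (1%:M : 'M[R]_n.+1) ua.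
by rewrite scalemx1; under eq_fun do rewrite scalemx1; apply.
Qed.

(** * The one-state plant *)

Section ScalarPlant.
Variables (R : realType) (a gamma : R).
Implicit Types k p w : R.

Let A : 'M[R]_1 := a%:M.
Let I1 : 'M[R]_1 := 1%:M.
Let C : 'M[R]_1 := 0.

Lemma closed_loop_scalar k : closed_loop A I1 k%:M = (a - k)%:M.
Proof. by rewrite /closed_loop mul1mx raddfB. Qed.

Lemma state_weight_scalar k : state_weight C I1 k%:M = (k ^+ 2)%:M.
Proof.
by rewrite /state_weight mulmx0 add0r mulmx1 tr_scalar_mx -scalar_mxM expr2.
Qed.

Lemma sigma_max_transfer_scalar k w :
  sigma_max (transfer A I1 C I1 I1 k%:M (Complex 0 w))
  = `|k| / Num.sqrt ((k - a) ^+ 2 + w ^+ 2).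
Proof.
rewrite /transfer closed_loop_scalar state_weight_scalar.
rewrite sqrt_mx_scalar ?sqr_ge0 // sqrtr_sqr /complex_mx !map_scalar_mx.
rewrite -[X in invmx X]raddfB invmx_scalar -!scalar_mxM rmorph1 mulr1.
rewrite sigma_max_scalar ComplexField.Normc.normcM ComplexField.Normc.normcV.
congr (_ / _); rewrite /= ?expr0n ?addr0 ?sqrtr_sqr ?normr_id //.
by congr Num.sqrt; ring.
Qed.

(** The modulus [|k| / sqrt ((k - a) ^ 2 + w ^ 2)] of the transfer function
    is largest at frequency [w = 0], so the norm is the static gain. *)
Lemma hinf_norm_scalar k :
  a < k -> hinf_norm A I1 C I1 I1 k%:M = (`|k| / (k - a))%:E.
Proof.
move=> ak; have ka0 : 0 < k - a by rewrite subr_gt0.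
apply/eqP; rewrite eq_le; apply/andP; split.
  apply: ge_ereal_sup => _ [w _ <-]; rewrite lee_fin sigma_max_transfer_scalar.
  rewrite ler_wpM2l // lef_pV2 ?posrE ?sqrtr_gt0 //; last first.
    by rewrite ltr_wpDr ?sqr_ge0 ?exprn_gt0.
  by rewrite -{1}(gtr0_norm ka0) -sqrtr_sqr ler_wsqrtr // lerDl sqr_ge0.
apply: ereal_sup_ubound; exists 0 => //.
by rewrite sigma_max_transfer_scalar expr0n /= addr0 sqrtr_sqr (gtr0_norm ka0).
Qed.

Lemma feasible_scalar k :
  feasible A I1 C I1 I1 gamma k%:M <-> a < k /\ `|k| < gamma * (k - a).
Proof.
rewrite /feasible /= closed_loop_scalar hurwitz_scalar subr_lt0.
by split=> -[ak]; rewrite hinf_norm_scalar // lte_fin ltr_pdivrMr ?subr_gt0.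
Qed.

Lemma riccati_residual_scalar k p :
  riccati_residual A I1 C I1 I1 gamma k%:M p%:M
  = (2 * (a - k) * p + k ^+ 2 + gamma ^- 2 * p ^+ 2)%:M.
Proof.
rewrite /riccati_residual closed_loop_scalar state_weight_scalar.
rewrite tr_scalar_mx trmx1 !mulmx1 -!scalar_mxM scale_scalar_mx -!raddfD /=.
by congr _%:M; ring.
Qed.

Lemma stabilizing_solution_scalar k p :
  stabilizing_solution A I1 C I1 I1 gamma k%:M p%:M <->
  [/\ 0 <= p, 2 * (a - k) * p + k ^+ 2 + gamma ^- 2 * p ^+ 2 = 0
    & a - k + gamma ^- 2 * p < 0].
Proof.
rewrite /stabilizing_solution riccati_residual_scalar closed_loop_scalar.
rewrite trmx1 !mul1mx scale_scalar_mx -raddfD /=.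
split=> -[/possemidef_scalar p0 e /hurwitz_scalar s]; split=> //.
  by apply: scalar_mx11_inj; rewrite e raddf0.
by rewrite e raddf0.
Qed.

Lemma cost_scalar k p :
  (forall P, stabilizing_solution A I1 C I1 I1 gamma k%:M P <-> P = p%:M) ->
  cost A I1 C I1 I1 gamma k%:M = p.
Proof.
move=> Pp; rewrite /cost /riccati_P (@xget_unique _ _ _ p%:M).
- by rewrite trmx1 !mulmx1 mxtrace_scalar.
- exact/Pp.
- by move=> P /Pp.
Qed.

End ScalarPlant.

(** * Gains approaching the boundary *)

Section BoundedCost.
Variable R : realType.
Implicit Type t : R.

(** Solves [2 k + 1 = t ^ 2] for [k], so that the square root of the
    discriminant of the Riccati quadratic is a multiple of [t]; the boundary is
    [t = 0]. *)
Definition gain t : R := (t ^+ 2 - 1) / 2.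

Lemma gain_feasible t : 0 < t ->
  feasible (-1)%:M 1%:M (0 : 'M[R]_1) 1%:M 1%:M 1 (gain t)%:M.
Proof.
move=> t0; apply/feasible_scalar; have := exprn_gt0 2 t0.
by rewrite /gain mul1r ltr_norml => t20; split; [lra|apply/andP; split; lra].
Qed.

(** At [k = -1/2] the static gain is exactly [1 = gamma], and feasibility asks
    for a strict inequality. *)
Lemma gain0_infeasible :
  ~ feasible (-1)%:M 1%:M (0 : 'M[R]_1) 1%:M 1%:M 1 (gain 0)%:M.
Proof.
by move=> /feasible_scalar[_]; rewrite /gain expr0n /= ltr_norml => /andP[]; lra.
Qed.

(** The Riccati quadratic factors as
    [(p - (1 - t) ^ 2 / 2) * (p - (1 + t) ^ 2 / 2)], and the matrix
    [A - B K + gamma ^ -2 D D^T P] that has to be Hurwitz takes the values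
    [- t] and [t] at these roots, which leaves only the first. *)
Lemma gain_stabilizing_solution t : 0 < t ->
  forall P, stabilizing_solution (-1)%:M 1%:M (0 : 'M[R]_1) 1%:M 1%:M 1
    (gain t)%:M P <-> P = ((1 - t) ^+ 2 / 2)%:M.
Proof.
move=> t0 P; rewrite [P]mx11_scalar; move: (P 0 0) => /= {P} p.
rewrite stabilizing_solution_scalar expr1n invr1 !mul1r.
split=> [[_ e s]|/scalar_mx11_inj ->].
  have : (p - (1 - t) ^+ 2 / 2) * (p - (1 + t) ^+ 2 / 2) = 0.
    by rewrite -e /gain; field.
  move/eqP; rewrite mulf_eq0 !subr_eq0 => /orP[/eqP -> //|/eqP pE].
  have tE : -1 - gain t + p = t by rewrite pE /gain; field.
  by exfalso; lra.
split; first by rewrite divr_ge0 ?sqr_ge0.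
  by rewrite /gain; field.
suff -> : -1 - gain t + (1 - t) ^+ 2 / 2 = - t by rewrite oppr_lt0.
by rewrite /gain; field.
Qed.

Lemma gain_cost_le t : 0 < t -> t <= 1 ->
  cost (-1)%:M 1%:M (0 : 'M[R]_1) 1%:M 1%:M 1 (gain t)%:M <= 2^-1.
Proof.
move=> t0 t1; rewrite (@cost_scalar _ _ _ _ ((1 - t) ^+ 2 / 2)).
  by nra.
exact: gain_stabilizing_solution.
Qed.

Lemma cvg_gain_harmonic :
  (gain (harmonic i))%:M @[i --> \oo] --> ((gain 0)%:M : 'M[R]_1).
Proof.
have t2 : harmonic i * harmonic i @[i --> \oo] --> (0 * 0 : R).
  exact: (cvgM cvg_harmonic cvg_harmonic).
have g : gain (harmonic i) @[i --> \oo] --> gain (0 : R).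
  apply: cvgM; last exact: cvg_cst.
  apply: cvgB; last exact: cvg_cst.
  exact: t2.
exact: cvg_scalar_mx.
Qed.

End BoundedCost.

Theorem lemmaA3 (R : realType) :
  exists (m d l n : nat) (A : 'M[R]_m) (B : 'M[R]_(m, d)) (C : 'M[R]_(l, m))
         (D : 'M[R]_(m, n)) (E : 'M[R]_(l, d)) (Rw : 'M[R]_d) (gamma : R),
    [/\ [/\ (0 < m)%N, (0 < d)%N, (0 < l)%N & (0 < n)%N],
        E^T *m row_mx C E = row_mx 0 Rw, posdef_mx Rw, 0 < gamma
      & exists (Ks : nat -> 'M[R]_(d, m)) (Kb : 'M[R]_(d, m)),
          [/\ forall i, feasible A B C D Rw gamma (Ks i),
              forall i, exists! P, stabilizing_solution A B C D Rw gamma (Ks i) P,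
              Ks i @[i --> \oo] --> Kb,
              frontier (feasible A B C D Rw gamma) Kb
            & ~ (cost A B C D Rw gamma (Ks i) @[i --> \oo] --> +oo)]].
Proof.
exists 1%N, 1%N, 1%N, 1%N, (-1)%:M, 1%:M, 0, 1%:M, 1%:M, 1%:M, 1.
split=> //; [by rewrite trmx1 mul1mx|exact: posdef_scalar|].
have t_gt0 i : 0 < harmonic i :> R by rewrite invr_gt0 ltr0n.
exists (fun i => (gain _ (harmonic i))%:M), (gain _ 0)%:M; split.
- by move=> i; exact: gain_feasible.
- move=> i; exists ((1 - harmonic i) ^+ 2 / 2)%:M; split.
    exact/gain_stabilizing_solution.
  by move=> P /gain_stabilizing_solution ->.
- exact: cvg_gain_harmonic.
- split; last by move=> /interior_subset; exact: gain0_infeasible.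
  apply: (closed_cvg _ (@closed_closure _ _) _ _ (cvg_gain_harmonic R)).
  by apply: nearW => i; apply: subset_closure; exact: gain_feasible.
- move=> /cvgryPge /(_ 1) [N _ /(_ N (leqnn N))]; apply/negP; rewrite -ltNge.
  have t_le1 : harmonic N <= 1 :> R by rewrite invf_le1 ?ltr0n // ler1n.
  apply: le_lt_trans (gain_cost_le _ _ (t_gt0 N) t_le1) _.
  by rewrite invf_lt1 ?ltr0n // ltr1n.
Qed.
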